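(* For any nonempty graphs $G$ and $H$ of orders $n\ge 2$ and $n'\ge 2$, respectively, $$\gamma_{\rm sp}(G\Box H)\le nn'-n-n'+4.$$ Furthermore, for any integers $n\ge 4$ and $n'\ge 4$, $$\gamma_{\rm sp}(K_n\Box K_{n'})=nn'-n-n'+4,$$ and for any integer $n\ge 3$, $$\gamma_{\rm sp}(K_n\Box K_3)=2n.$$
   Context: All graphs are finite, simple and undirected; a graph is nonempty if it has at least one edge; $K_m$ is the complete graph on $m$ vertices. For a vertex $v$, $N(v)$ is its set of neighbours; for $D\subseteq V(G)$, $\overline{D}=V(G)\setminus D$. A set $D\subseteq V(G)$ is a super dominating set of $G$ if for every $u\in\overline{D}$ there exists $v\in D$ such that $N(v)\cap\overline{D}=\{u\}$; the super domination number $\gamma_{\rm sp}(G)$ is the minimum cardinality of a super dominating set of $G$. The Cartesian product $G\Box H$ has vertex set $V(G)\times V(H)$, with $(g,h)$ adjacent to $(g',h')$ iff either $g=g'$ and $hh'\in E(H)$, or $gg'\in E(G)$ and $h=h'$. *)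

(* Defs.v *)
From mathcomp Require Import all_boot.

Set Implicit Arguments.
Unset Strict Implicit.
Unset Printing Implicit Defensive.

Record sgraph := SGraph {
  vertex :> finType;
  adj : rel vertex;
  adj_sym : symmetric adj;
  adj_irrefl : irreflexive adj }.

Definition nonempty_graph (G : sgraph) : Prop := exists u v : G, adj u v.

Section SuperDomination.
Variable G : sgraph.
Implicit Types (u v : G) (D : {set G}).

Definition nbhd v : {set G} := [set u | adj v u].

Definition super_dominating D : bool :=
  [forall u in ~: D, exists v in D, nbhd v :&: ~: D == [set u]].

Lemma super_dominatingP D :
  reflect (forall u, u \in ~: D ->
             exists2 v, v \in D & nbhd v :&: ~: D = [set u])
          (super_dominating D).
Proof.
apply: (iffP forall_inP) => sD u /sD.
  by case/exists_inP=> v vD /eqP ?; exists v.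
by case=> v vD /eqP ?; apply/exists_inP; exists v.
Qed.

Lemma super_dominating_setT : super_dominating setT.
Proof. by apply/super_dominatingP => u; rewrite setCT inE. Qed.

(* The default value [setT] of [arg min] satisfies the constraint by
   [super_dominating_setT], so this is a genuine minimum. *)
Definition gamma_sp : nat :=
  #|[arg min_(D < [set: G] | super_dominating D) #|D| ]|.

Lemma gamma_sp_min D : super_dominating D -> gamma_sp <= #|D|.
Proof.
rewrite /gamma_sp; case: arg_minnP => [|D0 _ minD0]; last exact: minD0.
exact: super_dominating_setT.
Qed.

Lemma gamma_sp_witness : exists2 D, super_dominating D & #|D| = gamma_sp.
Proof.
rewrite /gamma_sp; case: arg_minnP => [|D0 sD0 _]; last by exists D0.
exact: super_dominating_setT.
Qed.

End SuperDomination.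

Section CartesianProduct.
Variables G H : sgraph.

Definition cart_adj : rel (G * H)%type := fun x y =>
  (x.1 == y.1) && adj x.2 y.2 || adj x.1 y.1 && (x.2 == y.2).

Lemma cart_adj_sym : symmetric cart_adj.
Proof.
move=> x y; rewrite /cart_adj (eq_sym x.1) (eq_sym x.2).
by rewrite (adj_sym x.1) (adj_sym x.2).
Qed.

Lemma cart_adj_irrefl : irreflexive cart_adj.
Proof. by move=> x; rewrite /cart_adj !adj_irrefl andbF. Qed.

Definition cart_prod : sgraph := SGraph cart_adj_sym cart_adj_irrefl.

End CartesianProduct.

Section CompleteGraph.
Variable m : nat.

Definition complete_adj : rel 'I_m := fun i j => i != j.

Lemma complete_adj_sym : symmetric complete_adj.
Proof. by move=> i j; rewrite /complete_adj eq_sym. Qed.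

Lemma complete_adj_irrefl : irreflexive complete_adj.
Proof. by move=> i; rewrite /complete_adj eqxx. Qed.

Definition complete_graph : sgraph :=
  SGraph complete_adj_sym complete_adj_irrefl.

End CompleteGraph.

(* Main.v *)
Require Import Defs.
From mathcomp Require Import all_boot zify.

Set Implicit Arguments.
Unset Strict Implicit.
Unset Printing Implicit Defensive.

(** Upper bound: for edges g1g2 of G and h1h2 of H, take as complement the
    row g1 without its entries in columns h1, h2, together with the column h1
    without its entries in rows g1, g2; the row g2 and the column h2 contain
    the dominators. For K_n x K_3, the complement is a full column.
    Lower bound: K_n x K_m is the rook graph. If v privately dominates u along
    the row of u, then u is alone (within the complement of D) in its row and
    the column of v misses the complement; dually along columns. When both
    kinds of u occur, those of the first kind lie in distinct rows, avoiding an
    empty row and the rows of the second kind, so there are at most n - 2 of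
    them; dually there are at most m - 2 of the second kind. *)

Section LoneElements.
Variables (T U : finType) (f : T -> U).
Implicit Types (A C : {set T}).

(** [f] will be the row or the column projection of the rook graph, so one set of counting lemmas
    serves both directions. *)
Definition lone_in C u := [forall w in C, (f w == f u) ==> (w == u)].

Lemma lone_inP C u :
  reflect {in C, forall w, f w = f u -> w = u} (lone_in C u).
Proof.
apply: (iffP forall_inP) => lu w wC; last by apply/implyP=> /eqP/lu->.
by move/eqP=> e; apply/eqP; apply: (implyP (lu w wC)).
Qed.

Lemma lone_inj A C :
  A \subset C -> {in A, forall u, lone_in C u} -> {in A &, injective f}.
Proof.
move=> /subsetP sAC lA u v uA vA.
exact: (lone_inP _ _ (lA v vA)) (sAC u uA).
Qed.

Lemma card_lone A C :
  A \subset C -> {in A, forall u, lone_in C u} -> #|A| <= #|U|.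
Proof. by move=> sAC /(lone_inj sAC)/card_in_imset <-; apply: max_card. Qed.

(** The injective image of [A] misses two values: [f x], since a lone element shares its value with
    no other element of [C], and [j]. They differ because [f x] is attained on [C]. *)
Lemma card_lone_missed A C x j :
  A \subset C -> {in A, forall u, lone_in C u} ->
  x \in C :\: A -> {in C, forall w, f w != j} -> #|A| + 2 <= #|U|.
Proof.
move=> sAC lA /setDP[xC xA] Cj.
have fxj : f x != j by apply: Cj.
have dis : [disjoint f @: A & [set f x; j]].
  apply/pred0P=> y /=; apply/negP => /andP[/imsetP[w wA ->]].
  case/set2P => e; last by case/eqP: (Cj w (subsetP sAC w wA)).
  by case/negP: xA; rewrite (lone_inP _ _ (lA w wA) x xC).
rewrite -(card_in_imset (lone_inj sAC lA)) -(_ : #|[set f x; j]| = 2).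
  by move: dis; rewrite -(leq_card_setU _ _).2 => /eqP <-; apply: max_card.
by rewrite cards2 fxj.
Qed.

End LoneElements.

Lemma gamma_sp_compl_leq (G : sgraph) (C : {set G}) :
  {in C, forall u, exists2 v, v \notin C & nbhd v :&: C = [set u]} ->
  gamma_sp G + #|C| <= #|G|.
Proof.
move=> sC; rewrite -(cardsC C) addnC leq_add2l; apply: gamma_sp_min.
apply/super_dominatingP => u; rewrite setCK => /sC[v vC e].
by exists v; rewrite ?inE.
Qed.

Lemma nbhd_capP (G : sgraph) (C : {set G}) u v :
  u \in C -> adj v u -> {in C, forall w, adj v w -> w = u} ->
  nbhd v :&: C = [set u].
Proof.
move=> uC vu P; apply/setP => w; rewrite !inE.
by apply/andP/eqP => [[vw wC]|->]; first exact: P.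
Qed.

Lemma gamma_sp_cart_prod_leq (G H : sgraph) :
  nonempty_graph G -> nonempty_graph H ->
  gamma_sp (cart_prod G H) + (#|G| - 2 + (#|H| - 2)) <= #|G| * #|H|.
Proof.
move=> [g1 [g2 g12]] [h1 [h2 h12]].
have ng : g1 != g2 by apply: contraTneq g12 => ->; rewrite adj_irrefl.
have nh : h1 != h2 by apply: contraTneq h12 => ->; rewrite adj_irrefl.
have card_C2 (T : finType) (a b : T) : a != b -> #|~: [set a; b]| = #|T| - 2.
  by move=> nab; rewrite -(cardsC [set a; b]) cards2 nab addKn.
pose A : {set cart_prod G H} := [set x | (x.1 \notin [set g1; g2]) && (x.2 == h1)].
pose B : {set cart_prod G H} := [set x | (x.1 == g1) && (x.2 \notin [set h1; h2])].
have cA : #|A| = #|G| - 2.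
  rewrite -(card_C2 _ _ _ ng) -[RHS]muln1 -(cards1 h1) -cardsX.
  by apply: eq_card => x; rewrite !inE.
have cB : #|B| = #|H| - 2.
  rewrite -(card_C2 _ _ _ nh) -[RHS]mul1n -(cards1 g1) -cardsX.
  by apply: eq_card => x; rewrite !inE.
have cAB : #|A :|: B| = #|A| + #|B|.
  apply/eqP; rewrite (leq_card_setU A B).2; apply/pred0P => x /=; rewrite !inE.
  by case: eqP => //= _; rewrite andbF.
rewrite -cA -cB -cAB -card_prod; apply: gamma_sp_compl_leq => -[g h].
rewrite !inE /= => /orP[] /andP[].
  rewrite negb_or => /andP[/negbTE gg1 /negbTE gg2] /eqP->.
  (* Column [h2] misses the complement, and row [g], being neither [g1] nor [g2], meets it only in
     column [h1]. *)
  exists (g, h2); first by rewrite !inE /= gg1 (eq_sym h2) (negbTE nh) andbF.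
  apply: (@nbhd_capP (cart_prod _ _)); first by rewrite !inE /= gg1 gg2 eqxx.
    by rewrite /= /cart_adj /= eqxx adj_sym h12.
  move=> [g' h']; rewrite !inE /= /cart_adj /= => Cw /orP[].
    by case/andP=> /eqP e _; move: Cw; rewrite -e gg1 gg2 /= orbF => /eqP->.
  case/andP=> _ /eqP e; move: Cw.
  by rewrite -e eqxx (eq_sym h2) (negbTE nh) !andbF.
move=> /eqP->; rewrite negb_or => /andP[/negbTE hh1 /negbTE hh2].
exists (g2, h); first by rewrite !inE /= hh1 (eq_sym g2) (negbTE ng) andbF.
apply: (@nbhd_capP (cart_prod _ _)); first by rewrite !inE /= hh1 hh2 eqxx orbT.
  by rewrite /= /cart_adj /= eqxx adj_sym g12 orbT.
move=> [g' h']; rewrite !inE /= /cart_adj /= => Cw /orP[].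
  case/andP=> /eqP e _; move: Cw.
  by rewrite -e eqxx orbT (eq_sym g2) (negbTE ng).
by case/andP=> _ /eqP e; move: Cw; rewrite -e hh1 hh2 andbF andbT => /eqP->.
Qed.

Lemma nonempty_complete_graph m : 2 <= m -> nonempty_graph (complete_graph m).
Proof. by case: m => [|[|m]] // _; exists ord0, ord_max. Qed.

Lemma rook_adjE n m (x y : cart_prod (complete_graph n) (complete_graph m)) :
  adj x y = (x != y) && ((x.1 == y.1) || (x.2 == y.2)).
Proof.
case: x y => [a b] [c d]; rewrite /= /cart_adj /= /complete_adj xpair_eqE.
by do 2 case: eqP.
Qed.

Lemma gamma_sp_rook_column n m :
  2 <= m -> gamma_sp (cart_prod (complete_graph n) (complete_graph m)) + n <= n * m.
Proof.
case: m => [|[|m]] // _.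
set K := cart_prod _ _.
pose C : {set K} := [set x | x.2 == ord0 :> 'I_m.+2].
have cC : #|C| = n.
  rewrite -[RHS]muln1 -{1}(card_ord n) -(cards1 (ord0 : 'I_m.+2)) -cardsT -cardsX.
  by apply: eq_card => x; rewrite !inE.
have <- : #|K| = n * m.+2 by rewrite card_prod !card_ord.
rewrite -[X in _ + X]cC; apply: gamma_sp_compl_leq => -[i j]; rewrite inE /= => /eqP ->.
(* As there are at least two columns, that of [ord_max] is disjoint from [C]. *)
exists (i, ord_max); first by rewrite inE.
apply: (@nbhd_capP K); first by rewrite inE.
  by rewrite rook_adjE /= xpair_eqE eqxx.
move=> [i' j']; rewrite inE rook_adjE /= => /eqP->.
by rewrite orbF => /andP[_ /eqP->].
Qed.

Section RookLowerBound.
Variables n m : nat.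
Let K := cart_prod (complete_graph n) (complete_graph m).
Let row (x : K) : 'I_n := x.1.
Let col (x : K) : 'I_m := x.2.

Lemma rook_dominator (D : {set K}) u :
  super_dominating D -> u \in ~: D ->
  (lone_in row (~: D) u /\ exists j, {in ~: D, forall w, col w != j}) \/
  (lone_in col (~: D) u /\ exists i, {in ~: D, forall w, row w != i}).
Proof.
move=> /super_dominatingP sD uC; have [v vD e] := sD u uC.
(* Since [v] lies in [D], any complement element on a line through [v] is a neighbour of [v], hence
   equals [u]. *)
have only w : w \in ~: D -> (row v == row w) || (col v == col w) -> w = u.
  move=> wC vw; apply/set1P; rewrite -e !inE rook_adjE.
  rewrite -in_setC wC [_ || _]vw !andbT.
  by apply: contraTneq wC => <-; rewrite inE vD.
have uv : v != u by apply: contraTneq uC => <-; rewrite inE vD.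
have: u \in nbhd v :&: ~: D by rewrite e set11.
rewrite !inE rook_adjE uv => /andP[/= /orP[]/eqP vu _]; [left|right]; split.
- by apply/lone_inP => w wC wu; apply: only; rewrite // /row vu -[u.1]wu eqxx.
(* Such a [w] would be [u], which would then agree with [v] in both coordinates. *)
- exists (col v) => w wC; apply: contraNneq uv => wv.
  have wu : w = u by apply: only; rewrite // wv eqxx orbT.
  by rewrite -pair_eqE /= vu eqxx /= -wu eq_sym; apply/eqP.
- by apply/lone_inP => w wC wu; apply: only; rewrite // /col vu -[u.2]wu eqxx orbT.
- exists (row v) => w wC; apply: contraNneq uv => wv.
  have wu : w = u by apply: only; rewrite // wv eqxx.
  by rewrite -pair_eqE /= vu eqxx andbT -wu eq_sym; apply/eqP.
Qed.

Lemma card_rook_compl (D : {set K}) :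
  super_dominating D ->
  [|| #|~: D| <= n, #|~: D| <= m | #|~: D| + 4 <= n + m].
Proof.
move=> sD; set C := ~: D.
(* Elements of both kinds are put in [A]; those left in [C :\: A] must be of the column kind. *)
pose A := [set u in C | lone_in row C u && [exists j, [forall w in C, col w != j]]].
have sAC : A \subset C by apply/subsetP => u; rewrite inE => /andP[].
have lA : {in A, forall u, lone_in row C u} by move=> u; rewrite inE => /and3P[].
have lB u : u \in C :\: A ->
    lone_in col C u /\ exists i, {in C, forall w, row w != i}.
  case/setDP=> uC uA; case: (rook_dominator sD uC) => // -[lu [j Cj]].
  case/negP: uA; rewrite inE uC lu; apply/existsP; exists j.
  exact/forall_inP.
have sBC := subsetDl C A.
have lB1 : {in C :\: A, forall u, lone_in col C u} by move=> u /lB[].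
have [B0|[b bB]] := set_0Vmem (C :\: A).
  have -> : C = A by apply/eqP; rewrite eqEsubset sAC -setD_eq0 B0 eqxx.
  by have := card_lone sAC lA; rewrite card_ord => ->.
have [A0|[a aA]] := set_0Vmem A.
  have := card_lone sBC lB1; rewrite card_ord A0 setD0 => ->.
  by rewrite orbT.
have [_ [i Ci]] := lB b bB.
have [j /forall_inP Cj] : exists j, [forall w in C, col w != j].
  by apply/existsP; move: aA; rewrite inE => /and3P[].
have aCB : a \in C :\: (C :\: A) by rewrite setDDr setDv set0U inE aA (subsetP sAC).
(* The counts are crosswise: [b], of the column kind, supplies the extra occupied row and the empty
   row [i]; [a] does the same for columns. *)
have := card_lone_missed sAC lA bB Ci.
have := card_lone_missed sBC lB1 aCB Cj.
rewrite !card_ord; have := cardsID A C; rewrite (setIidPr sAC); lia.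
Qed.

Lemma gamma_sp_rook_geq :
  [|| n * m <= gamma_sp K + n, n * m <= gamma_sp K + m
    | n * m + 4 <= gamma_sp K + n + m].
Proof.
have [D sD <-] := gamma_sp_witness K.
have := card_rook_compl sD.
have : #|D| + #|~: D| = n * m by rewrite cardsC card_prod !card_ord.
lia.
Qed.

End RookLowerBound.

(* The subtractions never truncate: n * n' >= n + n' when n, n' >= 2. *)
Theorem theorem30 :
  (forall (G H : sgraph) (n n' : nat),
     nonempty_graph G -> nonempty_graph H ->
     #|G| = n -> #|H| = n' -> 2 <= n -> 2 <= n' ->
     gamma_sp (cart_prod G H) <= n * n' - n - n' + 4) /\
  (forall n n' : nat, 4 <= n -> 4 <= n' ->
     gamma_sp (cart_prod (complete_graph n) (complete_graph n'))
       = n * n' - n - n' + 4) /\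
  (forall n : nat, 3 <= n ->
     gamma_sp (cart_prod (complete_graph n) (complete_graph 3)) = 2 * n).
Proof.
split; [|split].
- move=> G H n n' nG nH <- <- G2 H2.
  have := gamma_sp_cart_prod_leq nG nH; nia.
- move=> n n' n4 n'4.
  have nG := nonempty_complete_graph (ltnW (ltnW n4)).
  have nH := nonempty_complete_graph (ltnW (ltnW n'4)).
  have := gamma_sp_cart_prod_leq nG nH.
  have := gamma_sp_rook_geq n n'.
  (* With both orders at least 4, [n + n' - 4] is at least [n] and at least [n'], so each
     alternative yields the lower bound. *)
  rewrite !card_ord; nia.
- move=> n n3.
  have := @gamma_sp_rook_column n 3 isT.
  (* The alternatives bound the complement by [n], 3 or [n - 1], hence by [n] in every case. *)
  have := gamma_sp_rook_geq n 3.
  lia.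
Qed.
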